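(* Let $f:\mathbb{R}^d\to\mathbb{R}$ be a differentiable function that satisfies the aiming condition and has a unique global minimizer. Then $f\in\mathcal{F}_{\mathbf{I}}^{\mathrm{BA}}(t)$ for every $t>0$.
   Context: For a set $\mathcal{X}$, $\Pi(x,\mathcal{X})=\arg\min_{y\in\mathcal{X}}\|x-y\|^2$ (the set of projections of $x$ onto $\mathcal{X}$). A differentiable $f:\mathbb{R}^d\to\mathbb{R}$ satisfies the aiming condition if $f_\star:=\min f=0$ and there exists $\theta>0$ such that for every $x\in\mathbb{R}^d$ there exists $\bar x\in\Pi(x,\mathcal{X}_f)$ with $\theta f(x)\le\langle\nabla f(x),x-\bar x\rangle$. Let $\langle\cdot,\cdot\rangle$, $\|\cdot\|$ be the Euclidean inner product and norm and $\mathcal{B}(x,t)=\{z\in\mathbb{R}^d:\|z-x\|\le t\}$. For $f:\mathbb{R}^d\to\mathbb{R}\cup\{+\infty\}$, $\operatorname{dom} f=\{x: f(x)<+\infty\}$; $f$ is proper if $\operatorname{dom} f\ne\emptyset$ and closed if it is lower semicontinuous; $\mathcal{X}_f$ is the set of global minimizers of $f$; $\mathrm{brox}^t_f(x)=\arg\min_{z\in\mathcal{B}(x,t)}f(z)$ (a set); $\mathcal{X}_f+\mathcal{B}(0,t)$ is the Minkowski sum. The class $\mathcal{F}_{\mathbf{I}}^{\mathrm{BA}}(t)$ consists of all proper, closed $f:\mathbb{R}^d\to\mathbb{R}\cup\{+\infty\}$ such that both of the following hold. (A) There exists $x_\star\in\mathcal{X}_f$ such that for every $x\in\operatorname{dom}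 f\setminus(\mathcal{X}_f+\mathcal{B}(0,t))$ and every $u\in\mathrm{brox}^t_f(x)$, $\langle x-u,\,x_\star-u\rangle\le 0$. (B) For all $x\in\operatorname{dom} f$: if $\mathrm{brox}^t_f(x)=\{x\}$, then $x\in\mathcal{X}_f$. *)

(* Defs.v *)
From HB Require Import structures.
From mathcomp Require Import all_boot all_order all_algebra.
From mathcomp Require Import all_classical all_reals all_analysis.
Import Order.TTheory GRing.Theory Num.Theory.
Import numFieldNormedType.Exports.

Set Implicit Arguments.
Unset Strict Implicit.
Unset Printing Implicit Defensive.

Local Open Scope classical_set_scope.
Local Open Scope ring_scope.

Definition argmin {disp : Order.disp_t} {T : Type} {K : porderType disp}
    (g : T -> K) (A : set T) : set T :=
  [set y | A y /\ forall z, A z -> (g y <= g z)%O].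

Definition minimizers {disp : Order.disp_t} {T : Type} {K : porderType disp}
    (g : T -> K) : set T := argmin g setT.

Definition minkowski_sum {V : zmodType} (A B : set V) : set V :=
  [set a + b | a in A & b in B].

(* The library norm on ['rV[R]_d] is the sup norm.  It is used below only
   through the topology and the derivatives it induces, which are those of the
   Euclidean norm [enorm]. *)
Section Euclidean.
Context {R : realType} {d : nat}.
Implicit Types (x y : 'rV[R]_d) (t : R).

Definition inner x y : R := \sum_(i < d) x 0 i * y 0 i.

Definition enorm x : R := Num.sqrt (inner x x).

Definition eball x t : set 'rV[R]_d := [set z | enorm (z - x) <= t].

Definition proj x (X : set 'rV[R]_d) : set 'rV[R]_d :=
  argmin (fun y => enorm (x - y) ^+ 2) X.

Definition gradient (f : 'rV[R]_d -> R) x : 'rV[R]_d :=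
  \row_(i < d) 'D_(delta_mx 0 i) f x.

Definition aiming (f : 'rV[R]_d -> R) : Prop :=
  (exists2 x, minimizers f x & f x = 0) /\
  exists2 theta : R, 0 < theta &
    forall x, exists2 xbar, proj x (minimizers f) xbar &
      theta * f x <= inner (gradient f x) (x - xbar).

Definition edom (f : 'rV[R]_d -> \bar R) : set 'rV[R]_d :=
  [set x | (f x < +oo)%E].

Definition brox (t : R) (f : 'rV[R]_d -> \bar R) x : set 'rV[R]_d :=
  argmin f (eball x t).

Definition BA_condA (t : R) (f : 'rV[R]_d -> \bar R) : Prop :=
  exists2 xstar, minimizers f xstar &
    forall x, (edom f `\` minkowski_sum (minimizers f) (eball 0 t)) x ->
      forall u, brox t f x u -> inner (x - u) (xstar - u) <= 0.

Definition BA_condB (t : R) (f : 'rV[R]_d -> \bar R) : Prop :=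
  forall x, edom f x -> brox t f x = [set x] -> minimizers f x.

(* The first conjunct encodes the codomain R U {+oo}, inside [\bar R]. *)
Definition class_BA (t : R) : set ('rV[R]_d -> \bar R) :=
  [set f | [/\ forall x, f x != -oo%E,
               edom f !=set0,
               lower_semicontinuous f,
               BA_condA t f
             & BA_condB t f]].

End Euclidean.

(* Main.v *)
Require Import Defs.
From HB Require Import structures.
From mathcomp Require Import all_boot all_order all_algebra.
From mathcomp Require Import all_classical all_reals all_analysis.
From mathcomp Require Import ring lra.
Import Order.TTheory GRing.Theory Num.Theory.
Import numFieldNormedType.Exports.

Set Implicit Arguments.
Unset Strict Implicit.
Unset Printing Implicit Defensive.

Local Open Scope classical_set_scope.
Local Open Scope ring_scope.

(** Write [xstar] for the minimizer.  Under the aiming condition every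
    [x <> xstar] has [f x > 0], and since [xstar] is the only possible
    projection, [0 < theta * f x <= <gradient f x, x - xstar>]: the segment from
    [x] towards [xstar] is a direction of strict descent
    ([aiming_derive_lt0]).  On the other hand, a minimizer of [f] over a set has
    no descent direction along which one can move a little without leaving the
    set ([argmin_derive_ge0]).  So a point [u <> xstar] minimizes [f] over
    [eball x t] only if the segment from [u] to [xstar] leaves the ball
    immediately.

    Both conditions of the class follow.  If [<x - u, xstar - u> > 0], the
    segment makes an acute angle with the direction of the center and stays in
    the ball at first ([near_eball_inward]), which is impossible unless
    [u = xstar], excluded in (A) because [xstar] is at distance more than [t]
    from [x].  If [u] is the center [x] itself, the segment always stays in the
    ball at first ([near_eball_center]), which gives (B). *)

Lemma inner_selfDZ (R : realType) (d : nat) (w v : 'rV[R]_d) (h : R) :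
  inner (h *: v + w) (h *: v + w) =
    inner w w + h * (inner w v *+ 2 + h * inner v v).
Proof.
rewrite /inner -sumrMnl !mulr_sumr -big_split mulr_sumr -big_split.
by apply: eq_bigr => i _ /=; rewrite !mxE; ring.
Qed.

Lemma innerNl (R : realType) (d : nat) (v w : 'rV[R]_d) :
  inner (- v) w = - inner v w.
Proof. by rewrite /inner -sumrN; apply: eq_bigr => i _; rewrite !mxE mulNr. Qed.

Lemma innerNr (R : realType) (d : nat) (v w : 'rV[R]_d) :
  inner v (- w) = - inner v w.
Proof. by rewrite /inner -sumrN; apply: eq_bigr => i _; rewrite !mxE mulrN. Qed.

(** Squaring turns membership in a ball into a polynomial inequality. *)
Lemma eballE (R : realType) (d : nat) (x z : 'rV[R]_d) (t : R) : 0 <= t ->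
  eball x t z <-> inner (z - x) (z - x) <= t ^+ 2.
Proof.
move=> t0; rewrite /eball /enorm /= -{1}(ger0_norm t0) -sqrtr_sqr.
by rewrite ler_sqrt ?sqr_ge0.
Qed.

Lemma near_mulr_le (R : realType) (a b : R) : 0 < b ->
  \forall h \near (0 : R)^'+, h * a <= b.
Proof.
move=> b0; apply: cvgr_le b0.
rewrite -[X in _ --> X](mul0r a); apply: cvgMl.
exact: cvg_at_right_filter cvg_id.
Qed.

(** Moving from [u] by [h *: v] changes the squared distance to [x] by
    [- 2 h <x - u, v> + h ^ 2 <v, v>], where the linear term wins for small
    [h]; this is why the acute angle has to be strict when [u] is on the
    sphere. *)
Lemma near_eball_inward (R : realType) (d : nat) (x u v : 'rV[R]_d) (t : R) :
  0 <= t -> eball x t u -> 0 < inner (x - u) v ->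
  \forall h \near (0 : R)^'+, eball x t (h *: v + u).
Proof.
move=> t0 /(eballE _ _ t0) ut; rewrite -(opprB u x) innerNl oppr_gt0 => wv.
near=> h; apply/(eballE _ _ t0); rewrite -addrA inner_selfDZ.
apply: le_trans ut; rewrite gerDl pmulr_rle0; last first.
  by near: h; exact: nbhs_right_gt.
suff : h * inner v v <= - (inner (u - x) v *+ 2) by lra.
by near: h; apply: near_mulr_le; lra.
Unshelve. all: by end_near. Qed.

Lemma near_eball_center (R : realType) (d : nat) (x v : 'rV[R]_d) (t : R) :
  0 < t -> \forall h \near (0 : R)^'+, eball x t (h *: v + x).
Proof.
move=> t0; near=> h; apply/(eballE _ _ (ltW t0)).
have h0 : 0 < h by near: h; exact: nbhs_right_gt.
have h1 : h * 1 <= t by near: h; exact: near_mulr_le.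
have hv : h * inner v v <= t by near: h; exact: near_mulr_le.
rewrite -addrA subrr inner_selfDZ.
(* Only [h * (h * inner v v)] survives, with both factors at most [t]. *)
have -> : inner (0 : 'rV[R]_d) 0 = 0 by apply: big1 => i _; rewrite !mxE mul0r.
have -> : inner 0 v = 0 by apply: big1 => i _; rewrite !mxE mul0r.
nra.
Unshelve. all: by end_near. Qed.

(** First-order necessary condition: a negative derivative makes the difference
    quotients negative for small [h > 0], at points which the minimizer should
    not exceed. *)
Lemma argmin_derive_ge0 (R : realType) (V : normedModType R) (f : V -> R)
    (A : set V) (u v : V) : derivable f u v -> argmin f A u ->
  (\forall h \near (0 : R)^'+, A (h *: v + u)) -> 0 <= 'D_v f u.
Proof.
move=> fuv [_ umin] Av; rewrite leNgt; apply/negP => Df0.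
have /cvg_dnbhs_at_right slope := fuv.
near (0 : R)^'+ => h.
have h0 : 0 < h by near: h; exact: nbhs_right_gt.
have : h^-1 *: (f (h *: v + u) - f u) < 0.
  by near: h; exact: cvgr_lt slope _ Df0.
apply/negP; rewrite -leNgt mulr_ge0 ?invr_ge0 ?(ltW h0)// subr_ge0.
by apply: umin; near: h.
Unshelve. all: by end_near. Qed.

(** Partial derivatives determine the directional ones because the
    differential is linear. *)
Lemma inner_gradient (R : realType) (d : nat) (f : 'rV[R]_d -> R)
    (x v : 'rV[R]_d) :
  differentiable f x -> inner (gradient f x) v = 'D_v f x.
Proof.
move=> fx; rewrite deriveE// [in RHS](row_sum_delta v) linear_sum.
by apply: eq_bigr => i _; rewrite mxE linearZ deriveE// mulrC.
Qed.

Lemma argmin_EFin (R : realType) (T : Type) (f : T -> R) (A : set T) :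
  argmin (fun x => (f x)%:E) A = argmin f A.
Proof. by apply/seteqP; split => y [Ay ymin]; split. Qed.

Lemma continuous_lower_semicontinuous (R : realType) (T : topologicalType)
    (f : T -> R) : continuous f -> lower_semicontinuous (fun x => (f x)%:E).
Proof.
move=> fcont x a; rewrite lte_fin => afx.
exists [set y | a < f y]; first exact: (cvgr_gt (f x) (fcont x) a afx).
by move=> y; rewrite lte_fin.
Qed.

(** Uniqueness of the minimizer enters twice: it makes [f x] positive at every
    other point, and it makes the projection in the aiming condition the same
    point [xstar] for all [x]. *)
Lemma aiming_derive_lt0 (R : realType) (d : nat) (f : 'rV[R]_d -> R)
    (xstar x : 'rV[R]_d) :
  differentiable f x -> aiming f -> minimizers f = [set xstar] ->
  x <> xstar -> 'D_(xstar - x) f x < 0.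
Proof.
move=> fx [[x0 [_ x0min] fx0] [theta theta0 aim]] Xf xxs.
have f_gt0 : 0 < f x.
  rewrite ltNge; apply/negP => fx_le0; apply: xxs.
  have : minimizers f x.
    by split=> // z _; rewrite (le_trans fx_le0)// -fx0 x0min.
  by rewrite Xf.
have [y [+ _] le_slope] := aim x; rewrite Xf => yE; rewrite {y}yE in le_slope.
rewrite -inner_gradient// -opprB innerNr oppr_lt0.
exact: lt_le_trans (mulr_gt0 theta0 f_gt0) le_slope.
Qed.

Theorem theorem5p4 (R : realType) (d : nat) (f : 'rV[R]_d -> R)
    (f_diff : forall x : 'rV[R]_d, differentiable f x)
    (f_aiming : aiming f)
    (f_unique : exists! x : 'rV[R]_d, minimizers f x) :
  forall t : R, 0 < t -> class_BA t (fun x : 'rV[R]_d => (f x)%:E).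
Proof.
move=> t t0; have [xstar [min_xstar uniq_xstar]] := f_unique.
have Xf : minimizers f = [set xstar].
  by apply/seteqP; split => [y /uniq_xstar|y ->].
(* Descent towards [xstar] against first-order optimality. *)
have not_argmin (A : set 'rV[R]_d) u : u <> xstar ->
    (\forall h \near (0 : R)^'+, A (h *: (xstar - u) + u)) -> ~ argmin f A u.
  move=> u_xstar feas u_argmin.
  have := aiming_derive_lt0 (f_diff u) f_aiming Xf u_xstar.
  apply/negP; rewrite -leNgt.
  by apply: argmin_derive_ge0 u_argmin feas; exact: diff_derivable.
split => //.
- by exists xstar; rewrite /edom /= ltry.
- by apply: continuous_lower_semicontinuous => x;
  exact: differentiable_continuous.
- exists xstar => // x [_ x_far] u.
  rewrite /brox argmin_EFin => u_brox.
  rewrite leNgt; apply/negP => inward.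
  apply: (not_argmin (eball x t) u) (u_brox); last first.
    by apply: near_eball_inward inward; [exact: ltW | case: u_brox].
  move=> u_xstar; apply: x_far; exists xstar => //.
  exists (x - xstar); last by rewrite addrC subrK.
  have [+ _] := u_brox; rewrite u_xstar !(eballE _ _ (ltW t0)).
  by rewrite subr0 -opprB innerNl innerNr opprK.
- move=> x _ brox_x; rewrite /minimizers argmin_EFin.
  have : brox t (fun x => (f x)%:E) x x by rewrite brox_x.
  rewrite /brox argmin_EFin => x_brox; apply: contrapT => x_min.
  apply: (not_argmin (eball x t) x) x_brox; last exact: near_eball_center.
  by move=> xE; apply: x_min; rewrite xE.
Qed.
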